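(* For $\delta\ge 0$ let $\gamma^\delta(k,r)=(k-\delta,3r+\delta)$. (i) If $X$ and $Y$ are non-empty finite subsets of a good metric space, then the normalized degree-Čech bifiltrations $\mathcal{D\check C}(X)$ and $\mathcal{D\check C}(Y)$ are $\gamma^\delta$-homotopy interleaved for all $\delta>d_{Pr}(\nu_X,\nu_Y)$. (ii) If $X$ and $Y$ are non-empty finite metric spaces, then the normalized degree-Rips bifiltrations $\mathcal{DR}(X)$ and $\mathcal{DR}(Y)$ are $\gamma^\delta$-homotopy interleaved for all $\delta>d_{GPr}(\mu_X,\mu_Y)$.
   Context: **Good metric spaces.** A metric space is good if the intersection of any finite collection of open balls is either empty or contractible. $B(x,r)$ denotes the open ball of radius $r$ centered at $x$. **Measures.** For $X$ a non-empty finite metric space, $\mu_X$ is the uniform probability measure, $\mu_X(A)=|A|/|X|$. If $X\subset Z$ for a metric space $Z$, $\nu_X$ is the Borel measure on $Z$ given by $\nu_X(A)=|A\cap X|/|X|$. The Prohorov distance between Borel measures $\mu,\eta$ on a metric space $Z$ is \[ d_{Pr}(\mu,\eta)=\sup_A\inf\{\delta\ge 0 \mid \mu(A)\le\eta(A^\delta)+\delta \text{ and } \eta(A)\le\mu(A^\delta)+\delta\}, \] where $A\subset Z$ ranges over closed sets and $A^\delta$ is the set of points of $Z$ at distance $<\delta$ from some $a\in A$. The Gromov–Prohorov distance between metric measure spaces $\mathcal X,\mathcal Y$ with measures $\eta_{\mathcal X},\eta_{\mathcal Y}$ is $d_{GPr}(\mathcal X,\mathcal Y)=\inf_{\varphi,\psi}d_{Pr}(\varphi_*\eta_{\mathcal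 X},\psi_*\eta_{\mathcal Y})$, where $\varphi:\mathcal X\to W$, $\psi:\mathcal Y\to W$ range over isometric embeddings into a common metric space $W$; a metric measure space is denoted by its measure. **Bifiltrations.** $J=(0,\infty)^{\mathrm{op}}\times(0,\infty)$, so $(k,r)\le(k',r')$ iff $k\ge k'$ and $r\le r'$. All bifiltrations below are functors from $J$ to topological spaces with internal maps inclusions; simplicial complexes are regarded as spaces via geometric realization. - For $X\subset Z$, the Čech complex $\check{\mathcal C}(X)_r$ is the nerve of the balls $B(x,r)\subset Z$, $x\in X$: its vertex set is $X$ (balls are indexed by their centers), and its simplices are the non-empty finite $\sigma\subset X$ with $\bigcap_{x\in\sigma}B(x,r)\ne\emptyset$. - For a metric space $(X,\partial_X)$, the Rips complex $\mathcal R(X)_r$ is the clique complex of the graph with vertex set $X$ and edges $[x,y]$, $x\neq y$, $\partial_X(x,y)<2r$. - For a simplicial complex $T$ and $k>0$, $\mathcal D(T)_k$ is the maximum subcomplex of $T$ all of whose vertices have degree at least $k-1$ in the 1-skeleton of $T$. - For $X$ non-empty finite, $\mathcal{D\check C}(X)_{(k,r)}=\mathcal D(\check{\mathcal C}(X)_r)_{k|X|}$ and $\mathcal{DR}(X)_{(k,r)}=\mathcal D(\mathcal R(X)_r)_{k|X|}$. **Interleavings.** A forward shift is a poset automorphism $\gamma$ of $\mathbb R^{\mathrm{op}}\times\mathbb R$ (ordered by $(a,b)\le(c,d)$ iff $a\ge c$ and $b\le d$) with $x\le\gamma(x)$ for all $x\in J$. For forward shifts $\gamma,\kappa$, the thin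 category $\mathbf I^{\gamma,\kappa}$ has objects $J\times\{0,1\}$ and a morphism $(r,i)\to(s,j)$ iff: $i=j$ and $r\le s$; or $i=0,j=1$ and $\gamma(r)\le s$; or $i=1,j=0$ and $\kappa(r)\le s$. Functors $F,G:J\to\mathbf{Top}$ are $(\gamma,\kappa)$-interleaved if there is a functor $\mathbf I^{\gamma,\kappa}\to\mathbf{Top}$ restricting to $F$ on $J\times\{0\}$ and to $G$ on $J\times\{1\}$. Functors $F,G:J\to\mathbf{Top}$ are weakly equivalent if they are connected by a finite zigzag of natural transformations each of which is objectwise a weak homotopy equivalence. $F,G$ are $(\gamma,\kappa)$-homotopy interleaved if there are $F'$ weakly equivalent to $F$ and $G'$ weakly equivalent to $G$ with $F',G'$ $(\gamma,\kappa)$-interleaved; $\gamma$-homotopy interleaved means $(\gamma,\gamma)$-homotopy interleaved. *)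

(* Defs.v *)
From HB Require Import structures.
From Stdlib Require Import Relation_Operators.
From mathcomp Require Import all_boot all_order all_algebra finmap.
From mathcomp Require Import all_classical all_reals all_analysis.
From mathcomp Require Import lra.

Set Implicit Arguments.
Unset Strict Implicit.
Unset Printing Implicit Defensive.

Import Order.TTheory GRing.Theory Num.Theory.
Import numFieldNormedType.Exports.

Local Open Scope classical_set_scope.
Local Open Scope ring_scope.

Section Homotopy.
Context (R : realType).
Implicit Types X Y : topologicalType.

Local Notation I := `[0 : R, 1 : R]%classic.

Definition homotopic X Y (f g : X -> Y) : Prop :=
  exists h : R * X -> Y, [/\ {within I `*` setT, continuous h},
    forall x, h (0, x) = f x & forall x, h (1, x) = g x].

Definition contractible X : Prop := exists x0 : X, homotopic id (cst x0).

Definition path_joined X (x y : X) : Prop :=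
  exists p : R -> X, [/\ {within I, continuous p}, p 0 = x & p 1 = y].

Definition path_component X (x : X) : set X := [set y | path_joined x y].

Definition pi0 X : set (set X) := range (@path_component X).

Definition pi0_map X Y (f : X -> Y) (C : set X) : set Y :=
  [set y | exists2 x, C x & path_joined (f x) y].

(** Only the values of the functions ['rV_n -> X] on the cube are relevant:
    the elements of [homotopy_group n x] are classes modulo [loop_homotopic],
    which does not see the other values. *)
Definition cube n : set 'rV[R]_n :=
  [set t | forall i, 0 <= t ord0 i <= 1].

Definition cube_boundary n : set 'rV[R]_n :=
  [set t | cube t /\ exists i, t ord0 i = 0 \/ t ord0 i = 1].

Definition loop n X (x : X) : set ('rV[R]_n -> X) :=
  [set a | {within @cube n, continuous a} /\
           forall t, cube_boundary t -> a t = x].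

Definition loop_homotopic n X (x : X) (a b : 'rV[R]_n -> X) : Prop :=
  exists h : R * 'rV[R]_n -> X,
    [/\ {within I `*` @cube n, continuous h},
        forall t, cube t -> h (0, t) = a t,
        forall t, cube t -> h (1, t) = b t &
        forall s t, I s -> cube_boundary t -> h (s, t) = x].

Definition loop_class n X (x : X) (a : 'rV[R]_n -> X) :
    set ('rV[R]_n -> X) :=
  [set b | loop x b /\ loop_homotopic x a b].

Definition homotopy_group n X (x : X) : set (set ('rV[R]_n -> X)) :=
  loop_class x @` loop x.
Arguments homotopy_group n [X] x.

Definition homotopy_group_map n X Y (f : X -> Y) (x : X)
    (C : set ('rV[R]_n -> X)) : set ('rV[R]_n -> Y) :=
  [set b | loop (f x) b /\ exists2 a, C a & loop_homotopic (f x) (f \o a) b].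

(** For [0 < n] the map induced by [f] on homotopy groups is a group morphism,
    so that it is an isomorphism as soon as it is bijective. *)
Definition weak_homotopy_equivalence X Y (f : X -> Y) : Prop :=
  [/\ continuous f,
      set_bij (@pi0 X) (@pi0 Y) (pi0_map f) &
      forall n (x : X), (0 < n)%N ->
        set_bij (homotopy_group n x) (homotopy_group n (f x))
          (homotopy_group_map f x)].

End Homotopy.

Record diagram (I : Type) (le : rel I) := Diagram {
  space :> I -> topologicalType;
  arrow : forall i j, le i j -> space i -> space j;
  arrow_continuous : forall i j (ij : le i j), continuous (arrow ij);
  arrow_id : forall i (ii : le i i) x, arrow ii x = x;
  arrow_comp : forall i j k (ij : le i j) (jk : le j k) (ik : le i k) x,
    arrow ik x = arrow jk (arrow ij x) }.
Arguments arrow_continuous [I le] d [i j] ij.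
Arguments arrow_id [I le] d [i] ii.
Arguments arrow_comp [I le] d [i j k] ij jk ik.

Definition natural (I : Type) (le : rel I) (F G : diagram le)
    (eta : forall i, F i -> G i) : Prop :=
  (forall i, continuous (eta i)) /\
  (forall i j (ij : le i j) x, eta j (arrow ij x) = arrow ij (eta i x)).

Section Restriction.
Context (I I' : Type) (le : rel I) (le' : rel I').
Context (f : I -> I') (f_homo : forall i j, le i j -> le' (f i) (f j)).
Context (H : diagram le').

Definition restriction : diagram le :=
  @Diagram I le (fun i => H (f i)) (fun i j ij => arrow (f_homo ij))
    (fun i j ij => arrow_continuous H (f_homo ij))
    (fun i ii => arrow_id H (f_homo ii))
    (fun i j k ij jk ik => arrow_comp H (f_homo ij) (f_homo jk) (f_homo ik)).

End Restriction.

Definition objectwise_weak_equivalence (R : realType) (I : Type) (le : rel I)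
    (F G : diagram le) : Prop :=
  exists eta : forall i, F i -> G i,
    natural eta /\ forall i, weak_homotopy_equivalence R (eta i).

(** The equivalence closure is the relation "joined by a finite zigzag". *)
Definition weakly_equivalent (R : realType) (I : Type) (le : rel I)
    (F G : diagram le) : Prop :=
  clos_refl_sym_trans (diagram le) (@objectwise_weak_equivalence R I le) F G.

Section Interleaving.
Context (R : realType).

(** The order of R^op x R. *)
Definition ple (x y : R * R) : bool := (y.1 <= x.1) && (x.2 <= y.2).

Definition J : Type := {x : R * R | (0 < x.1) && (0 < x.2)}.

Definition jle (x y : J) : bool := ple (val x) (val y).

Record forward_shift := ForwardShift {
  shift :> R * R -> R * R;
  shift_bij : bijective shift;
  shift_mono : forall x y, ple (shift x) (shift y) = ple x y;
  shift_ge : forall x : J, ple (val x) (shift (val x)) }.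

(** The thin category I^{gamma,kappa}; [false] and [true] are the levels 0
    and 1. *)
Definition ile (gamma kappa : forward_shift) (x y : J * bool) : bool :=
  match x.2, y.2 with
  | false, false | true, true => jle x.1 y.1
  | false, true => ple (gamma (val x.1)) (val y.1)
  | true, false => ple (kappa (val x.1)) (val y.1)
  end.

Definition level (b : bool) (x : J) : J * bool := (x, b).

Lemma level_homo gamma kappa b x y :
  jle x y -> ile gamma kappa (level b x) (level b y).
Proof. by case: b. Qed.

Definition interleaved (gamma kappa : forward_shift) (F G : diagram jle) :
    Prop :=
  exists H : diagram (ile gamma kappa),
    restriction (@level_homo gamma kappa false) H = F /\
    restriction (@level_homo gamma kappa true) H = G.

Definition homotopy_interleaved (gamma kappa : forward_shift)
    (F G : diagram jle) : Prop :=
  exists F' G' : diagram jle,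
    [/\ weakly_equivalent R F F', weakly_equivalent R G G' &
        interleaved gamma kappa F' G'].

Section Gamma.
Context (delta : R) (delta_ge0 : 0 <= delta).

Definition gamma_fun (x : R * R) : R * R := (x.1 - delta, 3 * x.2 + delta).

Lemma gamma_fun_bij : bijective gamma_fun.
Proof.
exists (fun x => (x.1 + delta, (x.2 - delta) / 3)) => -[k r];
  by rewrite /gamma_fun /=; congr pair; lra.
Qed.

Lemma gamma_fun_mono x y : ple (gamma_fun x) (gamma_fun y) = ple x y.
Proof. by rewrite /ple /= !lerD2r ler_pM2l. Qed.

Lemma gamma_fun_ge (x : J) : ple (val x) (gamma_fun (val x)).
Proof.
case: x => -[k r] /= /andP[_ r0]; rewrite /ple /=; apply/andP; split;
  move: r0 => /=; move: delta_ge0; lra.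
Qed.

Definition gamma_shift : forward_shift :=
  ForwardShift gamma_fun_bij gamma_fun_mono gamma_fun_ge.

End Gamma.

End Interleaving.

(** The vertices are the [v] such that [[set v]] is a simplex; they form the
    whole of [V] for the complexes below at positive scale. *)
Record complex (V : finType) := Complex {
  simplex :> {set V} -> Prop;
  simplex_neq0 : forall s, simplex s -> s != finset.set0;
  simplex_sub : forall s t : {set V}, simplex t -> s \subset t -> s != finset.set0 ->
    simplex s }.

Definition subcomplex (V : finType) (S T : complex V) : Prop :=
  forall s, simplex S s -> simplex T s.

Definition vertex (V : finType) (T : complex V) (v : V) : Prop :=
  simplex T [set v]%SET.

Definition degree (V : finType) (T : complex V) (v : V) : nat :=
  #|[set w : V | (w != v) && `[< simplex T [set v; w]%SET >]]%SET|.

Section DegreeComplex.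
Context (R : realType) (V : finType).
Implicit Types (S T : complex V) (k : R).

Lemma degree_complex_neq0 T k s :
  simplex T s /\ (forall v, v \in s -> k - 1 <= (degree T v)%:R) ->
  s != finset.set0.
Proof. by case=> /simplex_neq0. Qed.

Lemma degree_complex_sub T k (s t : {set V}) :
  simplex T t /\ (forall v, v \in t -> k - 1 <= (degree T v)%:R) ->
  s \subset t -> s != finset.set0 ->
  simplex T s /\ (forall v, v \in s -> k - 1 <= (degree T v)%:R).
Proof.
move=> [Tt deg_t] st s0; split; first exact: simplex_sub Tt st s0.
by move=> v /(fintype.subsetP st) /deg_t.
Qed.

Definition degree_complex T k : complex V :=
  Complex (@degree_complex_neq0 T k) (@degree_complex_sub T k).

Lemma degree_complex_max T k :
  [/\ subcomplex (degree_complex T k) T,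
      (forall v, vertex (degree_complex T k) v -> k - 1 <= (degree T v)%:R) &
      forall S, subcomplex S T ->
        (forall v, vertex S v -> k - 1 <= (degree T v)%:R) ->
        subcomplex S (degree_complex T k)].
Proof.
split=> [s [] //|v [_]|S ST degS s Ss]; first by apply; rewrite finset.set11.
split=> [|v vs]; first exact: ST.
apply: degS; apply: simplex_sub Ss _ _; first by rewrite finset.sub1set.
by apply/finset.set0Pn; exists v; rewrite finset.set11.
Qed.

Lemma degree_mono S T v : subcomplex S T -> (degree S v <= degree T v)%N.
Proof.
move=> ST; apply: subset_leq_card; apply/fintype.subsetP => w.
by rewrite !finset.inE => /andP[-> /asboolP /ST /asboolP].
Qed.

Lemma degree_complex_mono S T k l : subcomplex S T -> l <= k ->
  subcomplex (degree_complex S k) (degree_complex T l).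
Proof.
move=> ST lk s [Ss deg_s]; split=> [|v vs]; first exact: ST.
rewrite (le_trans _ (le_trans (deg_s v vs) _)) ?lerD2r// ler_nat.
exact: degree_mono.
Qed.

(** Barycentric coordinates; as [V] is finite, the coherent topology of the
    realization is the one induced by the product topology. *)
Definition realization T : set {ptws V -> R} :=
  [set p | [/\ forall v, 0 <= p v, \sum_v p v = 1 &
               simplex T [set v | p v != 0]%SET]].

Lemma realization_mono S T : subcomplex S T ->
  realization S `<=` realization T.
Proof. by move=> ST p [p0 p1 Sp]; split=> //; exact: ST. Qed.

Definition realization_map S T (ST : subcomplex S T) :
    set_type (realization S) -> set_type (realization T) :=
  fun p => exist _ (val p)
    (mem_set (realization_mono ST (set_mem (valP p)))).

Lemma realization_map_continuous S T (ST : subcomplex S T) :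
  continuous (realization_map ST).
Proof.
apply: continuous_comp_initial.
exact: (@initial_continuous _ _ (@set_val _ (realization S))).
Qed.

Section FilteredComplex.
Context (I : Type) (le : rel I) (T : I -> complex V).
Context (T_mono : forall i j, le i j -> subcomplex (T i) (T j)).

Definition filtered_complex : diagram le.
Proof.
apply: (@Diagram I le (fun i => set_type (realization (T i)))
  (fun i j ij => realization_map (T_mono ij))).
- by move=> i j ij; exact: realization_map_continuous.
- by move=> i ii x; exact: val_inj.
- by move=> i j k ij jk ik x; exact: val_inj.
Defined.

End FilteredComplex.

Section NormalizedDegree.
Context (C : R -> complex V).
Context (C_mono : forall r r', r <= r' -> subcomplex (C r) (C r')).

Definition normalized_degree_complex (x : J R) : complex V :=
  degree_complex (C (val x).2) ((val x).1 * #|V|%:R).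

Lemma normalized_degree_complex_mono x y : jle x y ->
  subcomplex (normalized_degree_complex x) (normalized_degree_complex y).
Proof.
move=> /andP[k r]; apply: degree_complex_mono; first exact: C_mono.
by rewrite ler_wpM2r.
Qed.

Definition normalized_degree : diagram (@jle R) :=
  filtered_complex normalized_degree_complex_mono.

End NormalizedDegree.

End DegreeComplex.

HB.structure Definition FinMetric (K : numDomainType) :=
  {M of Finite M & Metric K M}.
Notation finMetricType := FinMetric.type.

(** The collection of balls is required to be non-empty: the empty
    intersection, which would be [Z] itself, is not constrained. *)
Definition good (R : realType) (Z : metricType R) : Prop :=
  forall s : seq (Z * R), s <> [::] ->
    let A := \bigcap_(b in [set` s]) ball b.1 b.2 in
    A = set0 \/ contractible R (set_type A).

Section Cech.
Context (R : realType) (Z : metricType R) (X : {fset Z}) (r : R).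

Definition cech_simplex (s : {set X}) : Prop :=
  s != finset.set0 /\ exists z : Z, forall x, x \in s -> ball (val x) r z.

Lemma cech_simplex_neq0 s : cech_simplex s -> s != finset.set0.
Proof. by case. Qed.

Lemma cech_simplex_sub (s t : {set X}) : cech_simplex t -> s \subset t ->
  s != finset.set0 -> cech_simplex s.
Proof.
move=> [_ [z tz]] st s0; split=> //; exists z => x xs.
exact/tz/(fintype.subsetP st).
Qed.

Definition cech : complex X := Complex cech_simplex_neq0 cech_simplex_sub.

End Cech.

Lemma cech_mono (R : realType) (Z : metricType R) (X : {fset Z}) (r r' : R) :
  r <= r' -> subcomplex (cech X r) (cech X r').
Proof.
move=> rr' s [s0 [z sz]]; split=> //; exists z => x xs.
exact: le_ball rr' _ (sz x xs).
Qed.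

Definition degree_cech (R : realType) (Z : metricType R) (X : {fset Z}) :
  diagram (@jle R) := normalized_degree (@cech_mono R Z X).

Section Clique.
Context (V : finType) (e : V -> V -> Prop).

Definition clique (s : {set V}) : Prop :=
  s != finset.set0 /\
  forall x y, x \in s -> y \in s -> x != y -> e x y.

Lemma clique_neq0 s : clique s -> s != finset.set0.
Proof. by case. Qed.

Lemma clique_sub (s t : {set V}) : clique t -> s \subset t -> s != finset.set0 -> clique s.
Proof.
move=> [_ et] st s0; split=> // x y xs ys.
by apply: et; exact: (fintype.subsetP st).
Qed.

Definition clique_complex : complex V := Complex clique_neq0 clique_sub.

End Clique.

Definition rips (R : realType) (X : finMetricType R) (r : R) : complex X :=
  clique_complex (fun x y : X => mdist x y < 2 * r).

Lemma rips_mono (R : realType) (X : finMetricType R) (r r' : R) :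
  r <= r' -> subcomplex (rips X r) (rips X r').
Proof.
move=> rr' s [s0 es]; split=> // x y xs ys xy.
by rewrite (lt_le_trans (es x y xs ys xy))// ler_pM2l.
Qed.

Definition degree_rips (R : realType) (X : finMetricType R) :
  diagram (@jle R) := normalized_degree (@rips_mono R X).

Section UniformMeasure.
Context (R : realType) (T : choiceType) (X : {fset T}).

Definition uniform_measure (A : set T) : \bar R :=
  (#|` [fset x in X | x \in A]%fset|%:R / #|` X|%:R)%:E.

End UniformMeasure.

Section UniformMeasureInstance.
Context d (T : measurableType d) (R : realType) (X : {fset T}).

Let point_mass (i : nat) : {measure set T -> \bar R} := \d_(nth point X i).

Lemma uniform_measureE :
  uniform_measure R X = mscale ((#|` X|)%:R^-1 : R)%:nng (msum point_mass #|` X|).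
Proof.
apply/funext => A; rewrite /uniform_measure /mscale mulrC EFinM; congr (_ * _)%E.
transitivity (\sum_(0 <= i < #|` X|) point_mass i A)%E; last first.
  by rewrite big_mkord.
rewrite -(big_nth point xpredT (fun x => \d_x A)).
under eq_bigr do rewrite diracE.
rewrite sumEFin; congr EFin; rewrite card_fset_sum1 big_fset /=.
by rewrite natr_sum big_mkcond; apply: eq_bigr => x _; case: (x \in A).
Qed.

Let uniform0 : uniform_measure R X set0 = 0%E.
Proof. by rewrite uniform_measureE measure0. Qed.

Let uniform_ge0 A : (0 <= uniform_measure R X A)%E.
Proof. by rewrite uniform_measureE measure_ge0. Qed.

Let uniform_sigma_additive : semi_sigma_additive (uniform_measure R X).
Proof. by rewrite uniform_measureE; exact: measure_semi_sigma_additive. Qed.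

HB.instance Definition _ := isMeasure.Build _ _ _ (uniform_measure R X)
  uniform0 uniform_ge0 uniform_sigma_additive.

End UniformMeasureInstance.

Definition thickening (R : realType) (Z : metricType R) (A : set Z)
    (delta : R) : set Z :=
  [set z | exists2 a, A a & mdist a z < delta].

(** As for [pushforward], the measures are given by their underlying set
    functions; only their values on closed sets and on thickenings, which are
    open, are used. *)
Definition prohorov (R : realType) (Z : metricType R)
    (mu eta : set Z -> \bar R) : \bar R :=
  ereal_sup [set ereal_inf [set delta%:E | delta in [set delta : R |
      [/\ 0 <= delta,
          (mu A <= eta (thickening A delta) + delta%:E)%E &
          (eta A <= mu (thickening A delta) + delta%:E)%E]]]
    | A in [set A : set Z | closed A]].

Definition isometric_embedding (R : realType) (X Y : metricType R)
    (f : X -> Y) : Prop :=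
  forall x y, mdist (f x) (f y) = mdist x y.

Definition gromov_prohorov (R : realType) (X Y : metricType R)
    (mu : set X -> \bar R) (eta : set Y -> \bar R) : \bar R :=
  ereal_inf [set d | exists (W : metricType R) (phi : X -> W) (psi : Y -> W),
    [/\ isometric_embedding phi, isometric_embedding psi &
        d = prohorov (fun A => mu (phi @^-1` A)) (fun A => eta (psi @^-1` A))]].

Definition nu (R : realType) (Z : metricType R) (X : {fset Z}) :
  set Z -> \bar R := uniform_measure R X.

Definition mu (R : realType) (X : finMetricType R) : set X -> \bar R :=
  uniform_measure R [fset x | x in X]%fset.

(* Main.v *)
(** Put the points of X and Y into a common metric space and let H_(k,r) be the
    complex on the disjoint union of X and Y whose simplices satisfy the Cech
    (resp. Rips) condition with radius r at the points of X and radius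
    (r - delta)/3 at the points of Y, the points of X having degree at least
    k|X| - 1 at scale r and those of Y degree at least (k + delta)|Y| - 1 at
    scale (r - delta)/3. These complexes and the ones with X and Y exchanged are
    strictly interleaved by inclusions. Moreover the degree complex of X is a
    strong deformation retract of H_(k,r): if y is a vertex and s = (r - delta)/3,
    the ball of radius 2s around y has nu_Y-mass at least k + delta, so the set B
    of points of X at distance less than delta from it has nu_X-mass at least k.
    Any x in B lies within 2s + delta = r - s of y, hence the points of B are
    pairwise adjacent at scale r and y can be moved to x without leaving the
    simplices of H_(k,r). *)

Require Import Defs.
From mathcomp Require Import all_boot all_order all_algebra finmap.
From mathcomp Require Import all_classical all_reals all_analysis.
From mathcomp Require Import lra.

Set Implicit Arguments.
Unset Strict Implicit.
Unset Printing Implicit Defensive.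

Import Order.TTheory GRing.Theory Num.Theory.
Import numFieldNormedType.Exports.

Local Open Scope classical_set_scope.
Local Open Scope ring_scope.

(** * Strong deformation retracts are weak equivalences *)

Lemma within_continuous_comp_sub (U V W : topologicalType) (A : set U)
    (B : set V) (f : U -> V) (g : V -> W) :
  (forall x, A x -> B (f x)) -> {within A, continuous f} ->
  {within B, continuous g} -> {within A, continuous (g \o f)}.
Proof.
move=> AB /subspace_continuousP cf /subspace_continuousP cg.
apply/subspace_continuousP => x Ax; apply: cvg_comp (cg _ (AB _ Ax)) => P BP.
have := cf x Ax _ BP; rewrite !nbhs_simpl /= /within /=.
by apply: filterS => y Py Ay; exact: Py (AB _ Ay).
Qed.

Lemma continuous_pair (T U V : topologicalType) (f : T -> U) (g : T -> V) :
  continuous f -> continuous g -> continuous (fun x => (f x, g x)).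
Proof.
move=> cf cg x.
exact: (cvg_pair (cf x) (cg x)).
Qed.

(** * Homotopies on [D] held at a base point on [E] *)

Section RelativeHomotopy.
Context (R : realType) (P : topologicalType) (D E : set P).
Local Notation I := `[0 : R, 1 : R]%classic.

(** One notion for two uses: with the cube and its boundary it is [loop_homotopic]; with a single
    point and the empty set it describes paths. *)
Definition rel_homotopic (X : topologicalType) (x : X) (a b : P -> X) : Prop :=
  exists h : R * P -> X,
    [/\ {within I `*` D, continuous h},
        forall t, D t -> h (0, t) = a t,
        forall t, D t -> h (1, t) = b t &
        forall s t, I s -> E t -> h (s, t) = x].

Lemma rel_homotopic_refl (X : topologicalType) (x : X) (a : P -> X) :
  {within D, continuous a} -> (forall t, E t -> a t = x) ->
  rel_homotopic x a a.
Proof.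
move=> ca aE; exists (a \o snd); split=> // [|s t _ /aE//].
apply: within_continuous_comp_sub ca => [u [] //|].
by apply: continuous_subspaceT => u; exact: cvg_snd.
Qed.

Lemma rel_homotopic_sym (X : topologicalType) (x : X) (a b : P -> X) :
  rel_homotopic x a b -> rel_homotopic x b a.
Proof.
move=> [h [ch h0 h1 hE]]; exists (h \o (fun u => (1 - u.1, u.2))).
split=> [|t Dt|t Dt|s t Is Et] /=.
- apply: within_continuous_comp_sub ch => [[s t] [/=]|].
    by rewrite !in_itv /= => s01 Dt; split=> //; lra.
  apply: continuous_subspaceT; apply: continuous_pair => u; last exact: cvg_snd.
  by apply: (@cvgB _ R^o); [exact: cvg_cst|exact: cvg_fst].
- by rewrite subr0 h1.
- by rewrite subrr h0.
- by apply: hE => //; move: Is; rewrite /= !in_itv /=; lra.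
Qed.

Lemma rel_homotopic_map (X Y : topologicalType) (g : X -> Y) (x : X)
    (a b : P -> X) :
  continuous g -> rel_homotopic x a b ->
  rel_homotopic (g x) (g \o a) (g \o b).
Proof.
move=> cg [h [ch h0 h1 hE]]; exists (g \o h).
split=> [|t Dt|t Dt|s t Is Et] /=; last by rewrite hE.
- by apply: within_continuous_comp ch => y _; exact: cg.
- by rewrite h0.
- by rewrite h1.
Qed.

Lemma rel_homotopic_trans (X : topologicalType) (x : X) (a b c : P -> X) :
  closed D -> rel_homotopic x a b -> rel_homotopic x b c ->
  rel_homotopic x a c.
Proof.
move=> cD [h [ch h0 h1 hE]] [k [ck k0 k1 kE]].
(* The two homotopies run one after the other at double speed. As [D] is closed, so are the two
   slabs, and continuity can be checked on each separately. *)
pose f u := if u.1 <= 2^-1 then h (2 * u.1, u.2) else k (2 * u.1 - 1, u.2).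
have closed_slab (l m : R) : closed (`[l, m]%classic `*` D).
  rewrite (_ : _ `*` _ = (fst @^-1` `[l, m]%classic) `&` (snd @^-1` D)) //.
  apply: closedI; apply: closed_comp => //.
  - by move=> u _; exact: cvg_fst.
  - exact: itv_closed.
  - by move=> u _; exact: cvg_snd.
have cscale (c0 : R) :
    continuous (fun u : R * P => (2 * u.1 - c0, u.2) : R * P).
  apply: continuous_pair => u; last exact: cvg_snd.
  apply: (@cvgB _ R^o); last exact: cvg_cst.
  by apply: (@cvgM R); [exact: cvg_cst|exact: cvg_fst].
exists f; split=> [|t Dt|t Dt|s t Is Et].
- rewrite (_ : I `*` D =
      (`[0, 2^-1]%classic `*` D) `|` (`[2^-1, 1]%classic `*` D)).
    apply: withinU_continuous => //.
    + apply: (@subspace_eq_continuous _ _ _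
        (h \o (fun u => (2 * u.1 - 0, u.2)))).
        move=> [s t] /set_mem[/= + Dt]; rewrite in_itv /= => /andP[s0 s1].
        by rewrite /from_subspace /f /= s1 subr0.
      apply: within_continuous_comp_sub ch => [[s t] [/=]|].
        by rewrite !in_itv /= => s01 Dt; split=> //; lra.
      exact/continuous_subspaceT/cscale.
    + apply: (@subspace_eq_continuous _ _ _
        (k \o (fun u => (2 * u.1 - 1, u.2)))).
        move=> [s t] /set_mem[/= + Dt]; rewrite in_itv /= => /andP[s0 s1].
        rewrite /from_subspace /f /=; case: ifPn => // s2.
        (* The slabs meet at time 1/2, where both formulas give [b t]. *)
        have -> : s = 2^-1 by lra.
        by rewrite mulfV// subrr h1// k0.
      apply: within_continuous_comp_sub ck => [[s t] [/=]|].
        by rewrite !in_itv /= => s01 Dt; split=> //; lra.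
      exact/continuous_subspaceT/cscale.
  apply/seteqP; split=> [[s t] [/= + Dt]|[s t] [] [/= + Dt]];
    rewrite /= !in_itv /= => s01.
  + by case: (leP s 2^-1) => s2; [left|right];
      split=> //; lra.
  + by split=> //; lra.
  + by split=> //; lra.
- by rewrite /f /= invr_ge0 ler0n mulr0 h0.
- rewrite /f /= ifF; last by apply/negbTE; rewrite -ltNge; lra.
  by rewrite (_ : 2 * 1 - 1 = 1 :> R) ?k1//; lra.
- move: Is; rewrite /f /= in_itv /= => Is.
  by case: ifPn => s2; [apply: hE|apply: kE] => //=; rewrite in_itv /=; lra.
Qed.

End RelativeHomotopy.

(** [e] and [e'] are partial equivalence relations with domains [A] and [B], and [f], [g] are
    inverse up to them, so they descend to inverse bijections of classes. This serves for path
    components and homotopy groups alike. *)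
Lemma quotient_set_bij (S T : Type) (A : set S) (B : set T)
    (e : S -> S -> Prop) (e' : T -> T -> Prop) (f : S -> T) (g : T -> S)
    (F : set S -> set T) :
  (forall a b, e a b -> A a /\ A b) -> (forall a, A a -> e a a) ->
  (forall a b, e a b -> e b a) -> (forall a b c, e a b -> e b c -> e a c) ->
  (forall a b, e' a b -> B a /\ B b) -> (forall a, B a -> e' a a) ->
  (forall a b, e' a b -> e' b a) ->
  (forall a b c, e' a b -> e' b c -> e' a c) ->
  (forall a b, e a b -> e' (f a) (f b)) ->
  (forall a b, e' a b -> e (g a) (g b)) ->
  (forall a, A a -> e (g (f a)) a) -> (forall b, B b -> e' (f (g b)) b) ->
  (forall C, F C = [set b | exists2 a, C a & e' (f a) b]) ->
  set_bij ((fun a => [set b | e a b]) @` A) ((fun a => [set b | e' a b]) @` B) F.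
Proof.
move=> eA er es et eB er' es' et' fe ge gf fg FE.
have class_eq a b : e a b -> [set c | e a c] = [set c | e b c].
  move=> ab; apply/seteqP; split=> c /= h; last exact: et ab h.
  exact: et (es _ _ ab) h.
have class_eq' a b : e' a b -> [set c | e' a c] = [set c | e' b c].
  move=> ab; apply/seteqP; split=> c /= h; last exact: et' ab h.
  exact: et' (es' _ _ ab) h.
have Fclass a : A a -> F [set b | e a b] = [set b | e' (f a) b].
  move=> Aa; rewrite FE; apply/seteqP; split=> b /=.
    by move=> [c ac cb]; exact: et' (fe _ _ ac) cb.
  by move=> ab; exists a => //; exact: er.
have fA a : A a -> B (f a) by move=> /er /fe /eB[].
have gB b : B b -> A (g b) by move=> /er' /ge /eA[].
split.
- by move=> _ [a Aa <-]; rewrite Fclass//; exists (f a) => //; exact: fA.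
- move=> _ _ /set_mem[a Aa <-] /set_mem[b Ab <-]; rewrite !Fclass// => fab.
  (* [f b] lies in its own class, which by [fab] is that of [f a]. *)
  have : e' (f a) (f b) by rewrite -[e' _ _]/([set c | e' (f a) c] (f b)) fab;
    exact/er'/fA.
  move=> /ge gab; apply: class_eq.
  exact: (et _ _ _ (es _ _ (gf _ Aa)) (et _ _ _ gab (gf _ Ab))).
- move=> _ [b Bb <-]; exists [set c | e (g b) c].
    by exists (g b) => //; exact: gB.
  by rewrite Fclass; [apply: class_eq'; exact: fg|exact: gB].
Qed.

Section DeformationRetract.
Context (R : realType).
Implicit Types X Y : topologicalType.

(** Paths become homotopies between constant maps on a one-point domain, so their symmetry and
    transitivity follow from the relative case. *)
Lemma path_joinedE X (x y : X) : path_joined R x y <->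
  rel_homotopic R [set 0 : R] set0 x (cst x) (cst y).
Proof.
split=> [[p [cp p0 p1]]|[h [ch h0 h1 _]]].
  exists (p \o fst); split=> //=.
  apply: within_continuous_comp_sub cp => [u [] //|].
  by apply: continuous_subspaceT => u; exact: cvg_fst.
exists (h \o (fun s => (s, 0))); split=> //=; last 2 first.
- exact: h0.
- exact: h1.
apply: within_continuous_comp_sub ch => [s Is//|].
apply: continuous_subspaceT; apply: continuous_pair => s; last exact: cvg_cst.
exact: cvg_id.
Qed.

Lemma closed_cube n : closed (@cube R n).
Proof.
rewrite (_ : @cube R n =
    \bigcap_(i in setT) ((fun t : 'rV[R]_n => t ord0 i) @^-1` `[0, 1]%classic)).
  apply: closed_bigI => i _; apply: closed_comp; last exact: itv_closed.
  by move=> t _; exact: coord_continuous.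
by apply/seteqP; split=> t ct i; [move=> _|]; have := ct i; rewrite /= in_itv; exact.
Qed.

(** As [i] is fixed by the homotopy [h], no change of base point is needed. *)
Lemma deformation_retract_weak_equivalence X Y (i : X -> Y) (r : Y -> X)
    (h : R * Y -> Y) :
  continuous i -> continuous r -> continuous h -> cancel i r ->
  (forall y, h (0, y) = y) -> (forall y, h (1, y) = i (r y)) ->
  (forall s x, h (s, i x) = i x) -> weak_homotopy_equivalence R i.
Proof.
move=> ci cr ch ri h0 h1 hi.
have closed0 : closed [set 0 : R] by exact: closed_eq.
have joined_refl (Z : topologicalType) (z : Z) : path_joined R z z.
  by exists (cst z); split=> //; apply: continuous_subspaceT => u; exact: cvg_cst.
have rel_base (Z : topologicalType) (z z' : Z) a b :
    rel_homotopic R [set 0 : R] set0 z a b -> rel_homotopic R [set 0 : R] set0 z' a b.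
  by move=> [k [? ? ? _]]; exists k.
have joined_sym (Z : topologicalType) (x y : Z) : path_joined R x y -> path_joined R y x.
  by move=> /path_joinedE/rel_homotopic_sym/rel_base xy; apply/path_joinedE.
have joined_trans (Z : topologicalType) (x y z : Z) : path_joined R x y -> path_joined R y z ->
    path_joined R x z.
  move=> /path_joinedE xy /path_joinedE/rel_base yz; apply/path_joinedE.
  exact: rel_homotopic_trans xy (yz _).
have joined_map (Z Z' : topologicalType) (g : Z -> Z') x y : continuous g -> path_joined R x y ->
    path_joined R (g x) (g y).
  move=> cg [p [cp p0 p1]]; exists (g \o p); split=> //=.
  - by apply: within_continuous_comp cp => u _; exact: cg.
  - by rewrite p0.
  - by rewrite p1.
split=> //.
  apply: (@quotient_set_bij X Y setT setT (@path_joined R X) (@path_joined R Y)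
    i r) => //.
  - by move=> a b; exact: joined_sym.
  - by move=> a b c; exact: joined_trans.
  - by move=> a b; exact: joined_sym.
  - by move=> a b c; exact: joined_trans.
  - by move=> a b; exact: joined_map.
  - by move=> a b; exact: joined_map.
  - by move=> a _; rewrite ri.
  - move=> b _; apply: joined_sym; exists (fun s => h (s, b)); split=> //.
    apply: continuous_subspaceT => s.
    apply: (@continuous_comp _ _ _ (fun s => (s, b)) h); last exact: ch.
    by apply: continuous_pair => u; [exact: cvg_id|exact: cvg_cst].
move=> n x _.
(* Being loops is part of [e], so that it is reflexive exactly on loops, as [quotient_set_bij]
   requires. *)
pose e (Z : topologicalType) (z : Z) (a b : 'rV[R]_n -> Z) :=
  [/\ loop z a, loop z b & loop_homotopic z a b].
have e_sym (Z : topologicalType) (z : Z) a b : e Z z a b -> e Z z b a.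
  by move=> [la lb ab]; split=> //; exact: rel_homotopic_sym ab.
have e_trans (Z : topologicalType) (z : Z) a b c : e Z z a b -> e Z z b c -> e Z z a c.
  move=> [la _ ab] [_ lc bc]; split=> //.
  by apply: rel_homotopic_trans ab bc; exact: closed_cube.
have e_refl (Z : topologicalType) (z : Z) a : loop z a -> e Z z a a.
  by move=> [ca a1]; split=> //; apply: rel_homotopic_refl.
have loop_map (Z Z' : topologicalType) (g : Z -> Z') z (a : 'rV[R]_n -> Z) : continuous g ->
    loop z a -> loop (g z) (g \o a).
  move=> cg [ca az]; split=> [|t /az /= -> //].
  by apply: within_continuous_comp ca => u _; exact: cg.
have e_map (Z Z' : topologicalType) (g : Z -> Z') z a b : continuous g -> e Z z a b ->
    e Z' (g z) (g \o a) (g \o b).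
  move=> cg [la lb ab]; split; [exact: loop_map|exact: loop_map|].
  exact: rel_homotopic_map.
have groupE (Z : topologicalType) (z : Z) : @homotopy_group R n Z z =
    (fun a => [set b | e Z z a b]) @` loop z.
  apply: eq_imagel => a la; apply/seteqP; split=> b /=.
    by move=> [].
  by move=> [].
rewrite !groupE.
have [F FE] : exists F, forall C, F C =
    [set b | exists2 a, C a & e Y (i x) (i \o a) b].
  by exists (fun C => [set b | exists2 a, C a & e Y (i x) (i \o a) b]).
apply: (@eq_set_bijRL _ _ _ _ F).
  (* [homotopy_group_map] does not ask that [i \o a] be a loop; it agrees with [F] on classes, all
     of whose members are loops. *)
  move=> _ /set_mem[a la <-]; rewrite FE.
  apply/seteqP; split=> b /=.
    by move=> [c ac [? ? ?]]; split=> //; exists c.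
  move=> [lb [c [la' lc ac] cb]]; exists c; first by split.
  by split=> //; exact: loop_map.
apply: (@quotient_set_bij _ _ (@loop R n X x) (@loop R n Y (i x)) (e X x)
  (e Y (i x)) (fun a => i \o a) (fun b => r \o b) F) => //.
- by move=> a b [].
- exact: e_refl.
- exact: e_sym.
- exact: e_trans.
- by move=> a b [].
- exact: e_refl.
- exact: e_sym.
- exact: e_trans.
- by move=> a b; exact: e_map.
- by move=> a b /(e_map _ _ _ _ _ _ cr); rewrite ri.
- move=> a la; rewrite (_ : r \o (i \o a) = a); first exact: e_refl.
  by apply/funext => t /=; rewrite ri.
move=> b lb; apply: e_sym; split=> //.
  apply: (loop_map) => //; rewrite -[X in loop X _](ri x); exact: loop_map.
(* On the boundary [b] equals [i x], which [h] keeps fixed, so this is a based homotopy from [b] to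
   [i \o (r \o b)]. *)
exists (fun u => h (u.1, b u.2)); split=> //=.
- apply: (@within_continuous_comp _ _ _ _ (fun u => (u.1, b u.2)) h).
    by move=> y _; exact: ch.
  apply: continuous_pair.
    by apply: continuous_subspaceT => u; exact: cvg_fst.
  have [cb _] := lb.
  apply: (@within_continuous_comp_sub _ _ _ _ (@cube R n) snd b) => //.
    by move=> v [].
  by apply: continuous_subspaceT => v; exact: cvg_snd.
- by move=> s t _ /(proj2 lb) ->.
Qed.

End DeformationRetract.

(** * Contiguous maps *)

Lemma continuous_to_ptws (T V : topologicalType) (U : eqType)
    (f : T -> {ptws U -> V}) :
  (forall u, continuous (fun x => f x u)) -> continuous f.
Proof.
move=> cf x; apply/cvg_sup => u.
exact: (@continuous_comp_initial _ _ _ (fun g : U -> V => g u) f (cf u)).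
Qed.

Lemma continuous_sum (R : realType) (T : topologicalType) (I : finType)
    (P : pred I) (f : I -> T -> R) :
  (forall i, continuous (f i)) -> continuous (fun x => \sum_(i | P i) f i x).
Proof.
move=> cf; apply: continuous_big => [|i _]; last exact: cf.
exact: (@add_continuous R^o).
Qed.

(** * Geometric realization of simplicial maps *)

Section Realization.
Context (R : realType).
Local Notation space_of S := (set_type (@realization R _ S)).

(** The affine extension of [f] in barycentric coordinates. *)
Definition pushforward_weights (V V' : finType) (f : V -> V') (p : V -> R) :
    {ptws V' -> R} := fun w => \sum_(v | f v == w) p v.

(** Non-negative weights cannot cancel within a fibre. *)
Lemma pushforward_weights_support (V V' : finType) (f : V -> V')
    (p : V -> R) : (forall v, 0 <= p v) ->
  [set w | pushforward_weights f p w != 0]%SET =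
  [set f v | v in [set v | p v != 0]]%SET.
Proof.
move=> p0; apply/setP => w; rewrite finset.inE psumr_neq0//.
apply/hasP/imsetP => [[v _ /andP[/eqP <- pv]]|[v]].
  by exists v; rewrite // finset.inE gt_eqF.
by rewrite finset.inE => pv ->; exists v; rewrite ?mem_index_enum// eqxx lt0r pv p0.
Qed.

Lemma pushforward_weights_sum (V V' : finType) (f : V -> V') (p : V -> R) :
  \sum_w pushforward_weights f p w = \sum_v p v.
Proof. by rewrite (partition_big f xpredT). Qed.

Lemma pushforward_weights_comp (V V' V'' : finType) (f : V -> V')
    (g : V' -> V'') (p : V -> R) :
  pushforward_weights g (pushforward_weights f p) =
  pushforward_weights (g \o f) p.
Proof.
apply/funext => w; rewrite /pushforward_weights.
rewrite [RHS](partition_big f (fun v' => g v' == w))//.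
apply: eq_bigr => v' /eqP <-; apply: eq_bigl => v /=.
by case: eqP => [->|]; rewrite ?eqxx// andbF.
Qed.

Lemma pushforward_weights_id (V : finType) (f : V -> V) (p : V -> R) :
  f =1 id -> pushforward_weights f p = p.
Proof.
move=> fid; apply/funext => w; rewrite /pushforward_weights.
by under eq_bigl do rewrite fid; rewrite big_pred1_eq.
Qed.

Lemma continuous_coordinate (V : finType) (S : complex V) (v : V) :
  continuous (fun p : space_of S => (val p : V -> R) v).
Proof.
move=> p; apply: (@continuous_comp (space_of S) {ptws V -> R} R val (fun g => g v)).
  exact: (@initial_continuous _ _ (@set_val _ (@realization R V S))).
exact: (@proj_continuous V (fun=> R) v).
Qed.

Lemma continuous_to_realization (T : topologicalType) (V : finType)
    (S : complex V) (f : T -> space_of S) :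
  (forall v, continuous (fun x => (val (f x) : V -> R) v)) -> continuous f.
Proof.
by move=> cf; apply: continuous_comp_initial; exact: continuous_to_ptws.
Qed.

Lemma realizationE (V : finType) (S : complex V) (p : space_of S) :
  [/\ forall v, 0 <= (val p : V -> R) v, \sum_v (val p : V -> R) v = 1 &
      simplex S [set v | (val p : V -> R) v != 0]%SET].
Proof. exact: (set_mem (valP p)). Qed.

Section Simplicial.
Context (V V' : finType) (S : complex V) (T : complex V') (f : V -> V').
Context (f_simplicial : forall s, simplex S s -> simplex T (f @: s)%SET).

Lemma pushforward_realization p : @realization R V S p ->
  @realization R V' T (pushforward_weights f p).
Proof.
move=> [p0 p1 Sp]; split; first by move=> w; exact: sumr_ge0.
- by rewrite pushforward_weights_sum.
- by rewrite pushforward_weights_support//; exact: f_simplicial.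
Qed.

Definition simplicial_map (p : space_of S) :
    space_of T :=
  exist _ (pushforward_weights f (val p))
    (mem_set (pushforward_realization (set_mem (valP p)))).

Lemma continuous_simplicial_map : continuous simplicial_map.
Proof.
apply: continuous_to_realization => w /=.
by apply: continuous_sum => v; exact: continuous_coordinate.
Qed.

End Simplicial.

(** The straight-line homotopy from the identity to [i \o f]; the hypothesis on
    [s :|: (i \o f) @: s] says that these two maps are contiguous. *)
Lemma contiguous_retract_weak_equivalence (V V' : finType) (S : complex V)
    (T : complex V') (i : V -> V') (f : V' -> V)
    (iS : forall s, simplex S s -> simplex T (i @: s)%SET) :
  cancel i f -> (forall s, simplex T s -> simplex S (f @: s)%SET) ->
  (forall s, simplex T s -> simplex T (s :|: [set i (f v) | v in s])%SET) ->
  weak_homotopy_equivalence R (simplicial_map iS).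
Proof.
move=> fi fS ifS.
(* The homotopy must be continuous for all real times, so time is clamped to the unit interval. *)
pose clamp (s : R) := Num.max 0 (Num.min 1 s).
have clamp0 : clamp 0 = 0 by rewrite /clamp /Num.min ltr10 maxxx.
have clamp1 : clamp 1 = 1 by rewrite /clamp minxx; apply/max_idPr.
have clamp_ge0 s : 0 <= clamp s by rewrite le_max lexx.
have clamp_le1 s : clamp s <= 1 by rewrite ge_max ler01 ge_min lexx.
have clamp_cont : continuous clamp.
  move=> s; apply: continuous_max; first exact: cvg_cst.
  by apply: continuous_min; [exact: cvg_cst|exact: cvg_id].
pose line (s : R) (p : V' -> R) : {ptws V' -> R} := fun w =>
  (1 - clamp s) * p w + clamp s * pushforward_weights (i \o f) p w.
have line_realization s p : @realization R V' T p -> @realization R V' T (line s p).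
  move=> [p0 p1 Tp].
  have q0 w : 0 <= pushforward_weights (i \o f) p w by exact: sumr_ge0.
  have l0 w : 0 <= line s p w.
    by rewrite addr_ge0// mulr_ge0// subr_ge0.
  have l1 : \sum_v line s p v = 1.
    by rewrite big_split/= -!mulr_sumr pushforward_weights_sum p1 !mulr1 subrK.
  (* With [s] the support of [p], the support of a point of the segment lies in
     [s :|: (i \o f) @: s]; it is non-empty because the weights sum to 1. *)
  split=> //; apply: simplex_sub (ifS _ Tp) _ _.
    apply/fintype.subsetP => w; rewrite !finset.inE.
    rewrite -(pushforward_weights_support (i \o f) p0) finset.inE.
    rewrite -negb_and; apply: contraNN => /andP[/eqP pw /eqP qw].
    by rewrite /line pw qw !mulr0 addr0.
  apply: contra_eq_neq l1 => /setP l_eq0; rewrite big1 1?eq_sym ?oner_neq0// => v _.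
  by have := l_eq0 v; rewrite !finset.inE => /negbFE/eqP.
pose h (u : R * space_of T) : space_of T :=
  exist _ (line u.1 (val u.2))
    (mem_set (line_realization u.1 _ (set_mem (valP u.2)))).
apply: (@deformation_retract_weak_equivalence R _ _ _ (simplicial_map fS) h).
- exact: continuous_simplicial_map.
- exact: continuous_simplicial_map.
- apply: continuous_to_realization => w /= u.
  have cc : {for u, continuous (fun u : R * space_of T => clamp u.1)}.
    by apply: continuous_comp; [exact: cvg_fst|exact: clamp_cont].
  have cv v : continuous (fun u : R * space_of T =>
      (val u.2 : V' -> R) v).
    move=> u'; apply: (@continuous_comp _ _ _ snd
      (fun p : space_of T => (val p : V' -> R) v)).
      exact: cvg_snd.
    exact: continuous_coordinate.
  apply: (@cvgD _ R^o).
    by apply: (@cvgM R); [apply: (@cvgB _ R^o) => //; exact: cvg_cst|exact: cv].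
  apply: (@cvgM R); first exact: cc.
  by apply: (@continuous_sum R _ _ _ _ _ u) => v; exact: cv.
- move=> p; apply: val_inj => /=.
  by rewrite pushforward_weights_comp pushforward_weights_id.
- move=> p; apply: val_inj; apply/funext => w /=.
  by rewrite /line clamp0 subr0 mul1r mul0r addr0.
- move=> p; apply: val_inj; apply/funext => w /=.
  by rewrite /line clamp1 subrr mul1r mul0r add0r pushforward_weights_comp.
(* On the image of [i] the two ends of the segment coincide, as [(i \o f) \o i = i]. *)
- move=> s p; apply: val_inj; apply/funext => w /=.
  rewrite /line pushforward_weights_comp (_ : (i \o f) \o i = i).
    by rewrite -mulrDl subrK mul1r.
  by apply/funext => v /=; rewrite fi.
Qed.

End Realization.

(** * The interleaving *)

(** The Cech and the Rips complexes are treated together: [spread rho s] says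
    that the balls of radius [rho v] around the points [v] of [s] have a common
    point, respectively pairwise satisfy the Rips condition. *)
Section MixedComplex.
Context (R : realType) (W : metricType R) (X : bool -> finType).
Context (pos : forall b, X b -> W).
Local Notation V := {b : bool & X b}.
Local Notation inc b := (@Tagged bool b X).
Local Notation place v := (pos (tagged v)).
Context (C : forall b, R -> complex (X b)).
Context (C_mono : forall b r r', r <= r' -> subcomplex (C b r) (C b r')).
Context (spread : (V -> R) -> {set V} -> Prop).
(** Modelled on the inclusion of the ball at [v] in the ball at [w]. Passing to faces, enlarging
    radii and moving points are all instances. *)
Context (spread_transfer : forall (rho rho' : V -> R) (s t : {set V}),
  spread rho s ->
  (forall w, w \in t -> exists2 v, v \in s &
     mdist (place v) (place w) <= rho' w - rho v) ->
  spread rho' t).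
Context (spread_edge : forall (rho : V -> R) (s : {set V}) v w,
  spread rho s -> v \in s -> w \in s ->
  mdist (place v) (place w) < rho v + rho w).
Context (spread_complex : forall b r (s : {set X b}), 0 < r ->
  simplex (C b r) s <->
  s != finset.set0 /\ spread (fun=> r) [set inc b x | x in s]%SET).

Section Complex.
Context (a : bool -> R * R).
Local Notation rho := (fun v : V => (a (tag v)).2).

(** The degree is counted in the vertex's own complex, not in the mixed one, so that the vertices
    from one set obey exactly the condition of its degree complex. *)
Definition mixed_degree (v : V) : Prop :=
  (a (tag v)).1 * #|X (tag v)|%:R - 1 <=
    (degree (C (tag v) (a (tag v)).2) (tagged v))%:R.

Definition mixed_simplex (s : {set V}) : Prop :=
  [/\ s != finset.set0, spread rho s & forall v, v \in s -> mixed_degree v].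

Lemma mixed_simplex_neq0 s : mixed_simplex s -> s != finset.set0.
Proof. by case. Qed.

Lemma spread_sub r (s t : {set V}) : spread r t -> s \subset t -> spread r s.
Proof.
move=> rt st; apply: spread_transfer rt _ => w ws.
by exists w; [exact: (fintype.subsetP st)|rewrite mdistxx subrr].
Qed.

Lemma mixed_simplex_sub (s t : {set V}) : mixed_simplex t -> s \subset t ->
  s != finset.set0 -> mixed_simplex s.
Proof.
move=> [_ rt dt] st s0; split=> // [|v vs]; first exact: spread_sub rt st.
exact/dt/(fintype.subsetP st).
Qed.

Definition mixed_complex : complex V :=
  Complex mixed_simplex_neq0 mixed_simplex_sub.

End Complex.

Lemma mixed_complex_mono (a a' : bool -> R * R) :
  (forall b, ple (a b) (a' b)) ->
  subcomplex (mixed_complex a) (mixed_complex a').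
Proof.
move=> aa' s [s0 rs ds]; split=> // [|v vs].
  apply: spread_transfer rs _ => w ws; exists w => //.
  by rewrite mdistxx subr_ge0; case/andP: (aa' (tag w)).
have /andP[k r] := aa' (tag v).
apply: (le_trans _ (le_trans (ds v vs) _)).
  by rewrite lerD2r ler_wpM2r.
by rewrite ler_nat; apply: degree_mono; exact: C_mono.
Qed.

Context (delta : R) (delta_ge0 : 0 <= delta).
Context (X_gt0 : forall b, (0 < #|X b|)%N).
Context (mass_transport : forall b c (A : {set X b}), b != c ->
  #|A|%:R / #|X b|%:R <=
    #|[set x : X c | [exists y in A, mdist (pos y) (pos x) < delta]]%SET|%:R /
      #|X c|%:R + delta).

Local Notation gamma := (gamma_shift delta_ge0).

(** The inverse of [gamma]. Its radius can be non-positive; [spread_edge] at [v = w] then keeps the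
    points concerned out of all simplices. *)
Definition unshift (p : R * R) : R * R := (p.1 + delta, (p.2 - delta) / 3).

Definition params (b : bool) (p : R * R) (c : bool) : R * R :=
  if c == b then p else unshift p.

Lemma nearby_vertex b c (p : R * R) (y : X c) : 0 < p.1 -> c != b ->
  0 < p.2 ->
  spread (fun v => (params b p (tag v)).2) [set inc c y]%SET ->
  mixed_degree (params b p) (inc c y) ->
  exists2 x : X b, mdist (pos y) (pos x) <= p.2 - (unshift p).2 &
    mixed_degree (params b p) (inc b x).
Proof.
move=> k0 cb r0; have [q qE] : exists q, q = unshift p by exists (unshift p).
have [q1 q2] : q.1 = p.1 + delta /\ 3 * q.2 = p.2 - delta.
  by rewrite qE /unshift /=; split=> //; lra.
rewrite /mixed_degree /params /= (negbTE cb) eqxx -qE => sy dy.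
have q0 : 0 < q.2.
  have := spread_edge sy (finset.set11 _) (finset.set11 _).
  by rewrite mdistxx /= (negbTE cb); lra.
(* Adding [y] to its neighbours absorbs the [- 1] of the degree condition, so [A] has mass at least
   [p.1 + delta]. *)
pose A := (y |: [set w | (w != y) && `[< simplex (C c q.2) [set y; w]%SET >]])%SET.
have cardA : #|A| = (degree (C c q.2) y).+1.
  by rewrite cardsU1 finset.inE eqxx.
have distA w : w \in A -> mdist (pos y) (pos w) < 2 * q.2.
  rewrite !finset.inE => /orP[/eqP ->|/andP[_ /asboolP]].
    by rewrite mdistxx; lra.
  move=> /(spread_complex _ q0)[_ syw].
  have := @spread_edge _ _ (inc c y) (inc c w) syw.
  rewrite !imset_f ?finset.inE ?eqxx ?orbT// => /(_ isT isT) /=; lra.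
pose B := [set x : X b | [exists w in A, mdist (pos w) (pos x) < delta]]%SET.
have distB x : x \in B -> mdist (pos y) (pos x) <= p.2 - q.2.
  rewrite finset.inE => /existsP[w /andP[/distA yw wx]].
  (* [2 * q.2 + delta = p.2 - q.2], because [3 * q.2 = p.2 - delta]. *)
  have := metric_triangle (pos y) (pos w) (pos x).
  by move: yw wx q2; lra.
have cardB : p.1 * #|X b|%:R <= #|B|%:R.
  rewrite -ler_pdivlMr ?ltr0n//; have := mass_transport A cb; rewrite -/B cardA.
  have : q.1 <= (degree (C c q.2) y).+1%:R / #|X c|%:R.
    by rewrite ler_pdivlMr ?ltr0n// -natr1; move: dy; lra.
  by move: q1; lra.
have /card_gt0P[x xB] : (0 < #|B|)%N.
  by rewrite -(ltr0n R) (lt_le_trans _ cardB)// mulr_gt0 ?ltr0n.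
exists x; first by have := distB _ xB; rewrite -?qE; lra.
(* The [- 1] returns: [x] lies in [B] without being its own neighbour, while all other points of [B]
   are neighbours of [x]. *)
suff : (#|B| <= (degree (C b p.2) x).+1)%N.
  by rewrite -(ler_nat R) -natr1; move: cardB; lra.
rewrite (cardsD1 x) xB add1n ltnS; apply: subset_leq_card.
apply/fintype.subsetP => w /setD1P[wx wB]; rewrite finset.inE wx /=.
apply/asboolP/spread_complex => //; split.
  by apply/finset.set0Pn; exists x; rewrite !finset.inE eqxx.
(* Both points of the pair are within [p.2 - q.2] of [y], so the one-point simplex at [y] transfers
   to them. *)
apply: spread_transfer sy _ => v /imsetP[u uxw ->]; exists (inc c y).
  exact: finset.set11.
rewrite /= (negbTE cb); apply: distB.
by case/set2P: uxw => ->.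
Qed.

(** * Retraction of the mixed complex onto one degree complex *)

Section Retraction.
Context (b : bool) (p : J R).
Local Notation k := (val p).1.
Local Notation r := (val p).2.
Local Notation M := (mixed_complex (params b (val p))).
Local Notation S := (normalized_degree_complex (C b) p).
Local Notation rho := (fun v : V => (params b (val p) (tag v)).2).

Lemma inc_simplicial s : simplex S s -> simplex M [set inc b x | x in s]%SET.
Proof.
have /andP[k0 r0] := valP p.
move=> [Cs ds]; have [s0 rs] := (spread_complex _ r0).1 Cs; split.
- by rewrite imset_eq0.
- apply: spread_transfer rs _ => w ws; exists w => //.
  by case/imsetP: ws => x _ ->; rewrite mdistxx /params /= eqxx subrr.
- by move=> v /imsetP[x /ds dx ->]; rewrite /mixed_degree /params /= eqxx.
Qed.

Lemma exists_retraction : exists f : V -> X b, cancel (inc b) f /\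
  forall s v, simplex M s -> v \in s ->
    mdist (place v) (pos (f v)) <= r - rho v /\
    mixed_degree (params b (val p)) (inc b (f v)).
Proof.
have /andP[k0 r0] := valP p.
suff /choice[f fP] : forall v : V, exists x : X b,
    (forall x', v = inc b x' -> x = x') /\
    forall s, simplex M s -> v \in s -> 
      mdist (place v) (pos x) <= r - rho v /\
      mixed_degree (params b (val p)) (inc b x).
  exists f; split=> [x|s v]; first exact: (fP _).1.
  exact: (fP _).2.
move=> [c y]; have [<-|cb] := eqVneq c b.
  exists y; split=> [x' /eqP|s [_ _ ds] ys].
    by rewrite -[existT _ _ _]/(inc c y) eq_Tagged => /eqP.
  by split; [rewrite mdistxx /params /= eqxx subrr|exact: ds].
have [[s [Ms ys]]|nM] := pselect (exists s, simplex M s /\ existT X c y \in s).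
  have [_ rs ds] := Ms.
  (* Only the face [y] of [s] is used, so the chosen point does not depend on [s]. *)
  have y_sub : [set inc c y]%SET \subset s by rewrite finset.sub1set.
  have [x yx dx] := nearby_vertex k0 cb r0
    (spread_sub rs y_sub) (ds _ ys).
  exists x; split=> [x' [cb']|_ _ _]; first by rewrite cb' eqxx in cb.
  by split=> //; rewrite /params /= (negbTE cb).
(* A point in no simplex still needs a value: an arbitrary point of [X b]. *)
have /card_gt0P[x _] := X_gt0 b.
exists x; split=> [x' [cb']|s Ms ys]; first by rewrite cb' eqxx in cb.
by case: nM; exists s.
Qed.

(** The retraction moves a vertex by at most the gain in radius, so by [spread_transfer] the image
    of a simplex is a simplex, and so is its union with the original. *)
Lemma inc_weak_equivalence :
  weak_homotopy_equivalence R (@simplicial_map R _ _ _ _ _ inc_simplicial).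
Proof.
have /andP[k0 r0] := valP p.
have [f [fK fM]] := exists_retraction.
apply: (@contiguous_retract_weak_equivalence R _ _ _ _ _ _ inc_simplicial fK) => s Ms;
  have [s0 rs ds] := Ms.
- split=> [|_ /imsetP[v vs ->]]; last first.
    by have [_] := fM _ _ Ms vs; rewrite /mixed_degree /params /= eqxx.
  apply/spread_complex => //; split; first by rewrite imset_eq0.
  apply: spread_transfer rs _ => _ /imsetP[_ /imsetP[v vs ->] ->].
  by exists v => //; case: (fM _ _ Ms vs).
- split.
  + by rewrite finset.setU_eq0 (negbTE s0).
  + apply: spread_transfer rs _ => w; rewrite finset.inE.
    move=> /orP[ws|/imsetP[v vs ->]].
      by exists w => //; rewrite mdistxx subrr.
    exists v => //; have [vf _] := fM _ _ Ms vs; apply: (le_trans vf).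
    by rewrite lerD2r /params /= eqxx.
  + move=> w; rewrite finset.inE => /orP[/ds//|/imsetP[v vs ->]].
    by case: (fM _ _ Ms vs).
Qed.

End Retraction.

(** On a change of level, from [p] to [p'] with [gamma p] below [p'], one set passes from [p] to
    [unshift p'], which is above [p] since [unshift] inverts [gamma]; the other passes from
    [unshift p], below [p], to [p']. *)
Lemma params_mono (x y : J R * bool) : ile gamma gamma x y ->
  forall c, ple (params x.2 (val x.1) c) (params y.2 (val y.1) c).
Proof.
case: x y => [x i] [y j]; have /andP[x1 x2] := valP x.
have /andP[y1 y2] := valP y; move: delta_ge0 x1 x2 y1 y2.
rewrite /ile /jle /ple /params /unshift.
by case: i; case: j => /= d0 x1 x2 y1 y2 /andP[k r] [] /=;
  apply/andP; split; lra.
Qed.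

Theorem normalized_degree_interleaved :
  homotopy_interleaved gamma gamma (normalized_degree (@C_mono false))
    (normalized_degree (@C_mono true)).
Proof.
(* All the complexes live on the same vertex set, so every structure map, within or across levels,
   is an inclusion. *)
pose H : diagram (ile gamma gamma) :=
  @filtered_complex R _ _ _
    (fun i : J R * bool => mixed_complex (params i.2 (val i.1)))
    (fun i j ij => mixed_complex_mono (params_mono ij)).
have FH b : weakly_equivalent R (normalized_degree (@C_mono b))
    (restriction (@level_homo R gamma gamma b) H).
  apply: Relation_Operators.rst_step; exists (fun p => @simplicial_map R _ _ _ _ _ (@inc_simplicial b p)).
  split=> [|p]; last exact: inc_weak_equivalence.
  split=> [p|p q pq x]; first exact: continuous_simplicial_map.
  exact: val_inj.
by exists (restriction (@level_homo R gamma gamma false) H),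
  (restriction (@level_homo R gamma gamma true) H); split=> //; exists H.
Qed.

End MixedComplex.

(** * The Prohorov distance *)

Lemma uniform_measureE_fset (R : realType) (T : choiceType) (X : {fset T})
    (A : set T) :
  uniform_measure R X A =
  (#|[set x : X | `[< A (val x) >]]%SET|%:R / #|{: X}|%:R)%:E.
Proof.
rewrite /uniform_measure [in X in _ / X]cardfE; congr (_%:R / _)%:E.
set S := finset.finset _.
have -> : [fset x in X | x \in A]%fset = [fset val x | x in S]%fset.
  apply/fsetP => x; apply/idP/imfsetP => [|[y /= + ->]].
    rewrite !inE /= => /andP[xX /set_mem Ax].
    by exists [` xX]%fset => //=; rewrite finset.inE; apply/asboolP.
  rewrite finset.inE !inE => Ay; apply/andP; split; first exact: valP.
  by apply/mem_set; move: Ay; rewrite ?asboolE.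
by rewrite card_imfset /= -?cardE//; exact: val_inj.
Qed.

Lemma uniform_measureE_finType (R : realType) (T : finType) (A : set T) :
  uniform_measure R [fset x | x in T]%fset A =
  (#|[set x : T | `[< A x >]]%SET|%:R / #|T|%:R)%:E.
Proof.
rewrite /uniform_measure card_finset; congr (_%:R / _)%:E.
rewrite -card_finset; congr #|` _|; apply/fsetP => x.
by rewrite !inE.
Qed.

(** Some admissible [d] at [A] is less than [delta], and by monotonicity the inequalities survive
    enlarging it to [delta]. *)
Lemma prohorov_lt (R : realType) (Z : metricType R) (m n : set Z -> \bar R)
    (delta : R) (A : set Z) :
  (forall S T, S `<=` T -> (m S <= m T)%E) ->
  (forall S T, S `<=` T -> (n S <= n T)%E) ->
  (prohorov m n < delta%:E)%E -> closed A ->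
  (m A <= n (thickening A delta) + delta%:E)%E /\
  (n A <= m (thickening A delta) + delta%:E)%E.
Proof.
move=> m_le n_le mn cA.
have /ereal_inf_lt[_ [d [_ mA nA] <-]] := le_lt_trans (ereal_sup_ubound
  (ex_intro2 _ _ A cA erefl)) mn.
rewrite lte_fin => dd.
have thick : thickening A d `<=` thickening A delta.
  by move=> z [a Aa az]; exists a => //; exact: lt_trans dd.
split; [apply: (le_trans mA)|apply: (le_trans nA)];
  by apply: leeD; [auto|rewrite lee_fin ltW].
Qed.

(** The image of [A] is finite, hence closed, so the Prohorov inequalities apply to it; its preimage
    under [pos] contains [A]. *)
Lemma mass_transport_prohorov (R : realType) (W : metricType R)
    (X : bool -> finType) (pos : forall b, X b -> W)
    (m : bool -> set W -> \bar R) (delta : R) :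
  (forall b S, m b S =
     (#|[set x : X b | `[< S (pos b x) >]]%SET|%:R / #|X b|%:R)%:E) ->
  (prohorov (m false) (m true) < delta%:E)%E ->
  forall b c (A : {set X b}), b != c ->
  #|A|%:R / #|X b|%:R <=
    #|[set x : X c | [exists y in A, mdist (pos b y) (pos c x) < delta]]%SET|%:R
      / #|X c|%:R + delta.
Proof.
move=> mE mlt b c A bc.
have m_le d S T : S `<=` T -> (m d S <= m d T)%E.
  move=> ST; rewrite !mE lee_fin ler_wpM2r// ler_nat; apply: subset_leq_card.
  apply/fintype.subsetP => x; rewrite !finset.inE => /asboolP Sx.
  exact/asboolP/ST.
pose S := [set pos b y | y in [set` A]].
have cS : closed S.
  have /accessible_finite_set_closed := hausdorff_accessible (@metric_hausdorff R W).
  by apply; apply: finite_image; exact: finite_finset.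
have : (m b S <= m c (thickening S delta) + delta%:E)%E.
  have := prohorov_lt (m_le false) (m_le true) mlt cS.
  (* [b] selects which of the two symmetric inequalities is used. *)
  by move: S {cS} => S; case: b c bc A => [] [] // _ _ [].
rewrite !mE lee_fin => mbc; apply: (le_trans _ (le_trans mbc _)).
  rewrite ler_wpM2r// ler_nat; apply: subset_leq_card.
  apply/fintype.subsetP => y yA; rewrite finset.inE; apply/asboolP.
  by exists y.
rewrite lerD2r ler_wpM2r// ler_nat; apply: subset_leq_card.
apply/fintype.subsetP => x; rewrite !finset.inE => /asboolP[_ [y yA <-] yx].
by apply/existsP; exists y; rewrite yA.
Qed.

(** * The Čech and Rips conditions with variable radii *)

Section Spread.
Context (R : realType) (W : metricType R) (V : finType) (place : V -> W).
Implicit Types (rho : V -> R) (s t : {set V}).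

Definition cech_spread rho s : Prop :=
  exists z, forall v, v \in s -> mdist (place v) z < rho v.

(** The same common point [z] works, as the ball at [v] lies in the ball at [w]. *)
Lemma cech_spread_transfer rho rho' s t : cech_spread rho s ->
  (forall w, w \in t -> exists2 v, v \in s &
     mdist (place v) (place w) <= rho' w - rho v) ->
  cech_spread rho' t.
Proof.
move=> [z sz] st; exists z => w /st[v /sz vz vw].
have := metric_triangle (place w) (place v) z.
by rewrite (metric_sym (place w) (place v)); move: vz vw; lra.
Qed.

Lemma cech_spread_edge rho s v w : cech_spread rho s -> v \in s -> w \in s ->
  mdist (place v) (place w) < rho v + rho w.
Proof.
move=> [z sz] /sz vz /sz wz; have := metric_triangle (place v) z (place w).
by rewrite (metric_sym z); move: vz wz; lra.
Qed.

(** The case [v = w] forces [rho] to be positive on [s]. *)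
Definition rips_spread rho s : Prop := forall v w, v \in s -> w \in s ->
  mdist (place v) (place w) < rho v + rho w.

(** In the triangle inequality along [w], [v], [v'], [w'] the terms [rho v] and [rho v'] cancel. *)
Lemma rips_spread_transfer rho rho' s t : rips_spread rho s ->
  (forall w, w \in t -> exists2 v, v \in s &
     mdist (place v) (place w) <= rho' w - rho v) ->
  rips_spread rho' t.
Proof.
move=> ss st w w' /st[v vs vw] /st[v' vs' vw'].
have := ss _ _ vs vs'.
have := metric_triangle (place w) (place v) (place w').
have := metric_triangle (place v) (place v') (place w').
by rewrite (metric_sym (place w) (place v)); move: vw vw'; lra.
Qed.

End Spread.

Theorem theorem1p7 (R : realType) :
  (forall (Z : metricType R) (X Y : {fset Z}),
     good Z -> X != fset0 -> Y != fset0 ->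
     forall (delta : R) (delta_ge0 : 0 <= delta),
       (prohorov (nu X) (nu Y) < delta%:E)%E ->
       homotopy_interleaved (gamma_shift delta_ge0) (gamma_shift delta_ge0)
         (degree_cech X) (degree_cech Y)) /\
  (forall X Y : finMetricType R,
     (0 < #|X|)%N -> (0 < #|Y|)%N ->
     forall (delta : R) (delta_ge0 : 0 <= delta),
       (gromov_prohorov (@mu R X) (@mu R Y) < delta%:E)%E ->
       homotopy_interleaved (gamma_shift delta_ge0) (gamma_shift delta_ge0)
         (degree_rips X) (degree_rips Y)).
Proof.
split=> [Z X0 X1 _ X0_neq0 X1_neq0 delta delta_ge0 X01|
         X0 X1 X0_gt0 X1_gt0 delta delta_ge0].
  pose X b := if b then X1 else X0.
  apply: (@normalized_degree_interleaved R Z (fun b => X b)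
    (fun b => val) (fun b => cech (X b)) (fun b => @cech_mono R Z (X b))
    (@cech_spread R Z _ (fun v => val (tagged v)))).
  - exact: cech_spread_transfer.
  - exact: cech_spread_edge.
  - move=> b r s _; split=> [[s0 [z sz]]|[s0 [z sz]]]; split=> //; exists z.
      by move=> _ /imsetP[x /sz + ->]; rewrite ballEmdist.
    by move=> x xs; rewrite ballEmdist; exact: (sz _ (imset_f _ xs)).
  - by case; rewrite -cardfE cardfs_gt0.
  - apply: (@mass_transport_prohorov R Z (fun b => X b) (fun b => val)
      (fun b => nu (X b))) => // b S; exact: uniform_measureE_fset.
(* An infimum below [delta] yields embeddings into one space [W] whose pushforward measures are at
   Prohorov distance below [delta]; distances, hence Rips complexes, can be computed in [W]. *)
move=> /ereal_inf_lt[_ [W [phi [psi [phi_iso psi_iso ->]]]] X01].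
pose X b : finMetricType R := if b then X1 else X0.
pose pos b : X b -> W := if b is true then psi else phi.
have pos_iso b (x y : X b) : mdist (pos b x) (pos b y) = mdist x y.
  by case: b x y => x y; [exact: psi_iso|exact: phi_iso].
apply: (@normalized_degree_interleaved R W (fun b => X b)
  pos (fun b => rips (X b)) (fun b => @rips_mono R (X b))
  (@rips_spread R W _ (fun v => pos _ (tagged v)))).
- exact: rips_spread_transfer.
- by move=> rho s v w; exact.
- move=> b r s r0; split=> [[s0 ss]|[s0 ss]]; split=> //.
    move=> _ _ /imsetP[x xs ->] /imsetP[y ys ->] /=.
    rewrite pos_iso (_ : r + r = 2 * r); last by lra.
    (* The clique condition concerns distinct points only; for equal ones the inequality is
       [0 < 2 * r]. *)
    have [->|xy] := eqVneq x y; last exact: ss.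
    by rewrite mdistxx mulr_gt0.
  move=> x y xs ys _; have := ss _ _ (imset_f _ xs) (imset_f _ ys).
  by rewrite /= pos_iso; lra.
- by case.
- apply: (@mass_transport_prohorov R W (fun b => X b) pos
    (fun b S => mu (pos b @^-1` S))); last exact: X01.
  by move=> b S; exact: uniform_measureE_finType.
Qed.
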